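(* Fix a positive integer $n$ and integers $w_1\geq w_2\geq\cdots\geq w_n\geq 0$, and set $d_{\underline{w}}=n^3\cdot w_1\cdot(2n+w_1)$. Then for every integer $d\geq d_{\underline{w}}$ and every tuple of integers $C_1\geq C_2\geq\cdots\geq C_n$ satisfying $$C_i+C_{i+1}+\cdots+C_n\;\geq\; d\cdot(w_i+w_{i+1}+\cdots+w_n)+b\big((w_i,w_{i+1},\dots,w_n)\big)\quad\text{for each } i=1,\dots,n,$$ the problem $\mathfrak{BP}(d,\underline{C};\underline{w})$ is feasible. Moreover, if the weights $w_1>w_2>\cdots>w_n$ are distinct, then for every $d\geq d_{\underline{w}}$ and every index $i_0\in\{1,\dots,n\}$, if the inequality above for $i=i_0$ is relaxed to $$C_{i_0}+\cdots+C_n\geq d\cdot(w_{i_0}+\cdots+w_n)+b\big((w_{i_0},\dots,w_n)\big)-1$$ (keeping the inequalities for $i\neq i_0$), then there exists a tuple of integers $C_1\geq\cdots\geq C_n$ satisfying the relaxed system of inequalities for which $\mathfrak{BP}(d,\underline{C};\underline{w})$ is infeasible.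
   Context: Partitioning problem: fix $n\geq 1$, weights $w_1\geq\cdots\geq w_n\geq 0$ (integers), a positive integer $d$ and integer capacities $C_1\geq\cdots\geq C_n$. Let $\mathcal{B}$ be the multiset of $d\cdot n$ balls consisting of $d$ balls of weight $w_i$ for each $i=1,\dots,n$. The problem $\mathfrak{BP}(d,\underline{C};\underline{w})$ asks for a partition $\mathcal{B}=\mathcal{B}_1\sqcup\cdots\sqcup\mathcal{B}_n$ (the bins) such that each $\mathcal{B}_i$ has exactly $d$ balls and $w(\mathcal{B}_i):=\sum_{w\in\mathcal{B}_i}w\leq C_i$ for all $i$; the problem is feasible if such a partition exists. The constant $b(\lambda)$: let $\lambda=(\lambda_1\geq\cdots\geq\lambda_r\geq 0)$ be a tuple of non-negative integers of length $r$ (trailing zeros count toward $r$). Its conjugate partition is $\lambda'=(\lambda'_1,\dots,\lambda'_{\lambda_1})$ with $\lambda'_j=\#\{i:\lambda_i\geq j\}$. Write $\lambda'=(r^{a_0},h_1^{a_1},\dots,h_k^{a_k})$ (where $c^{a}$ denotes $a$ repeated entries equal to $c$) with $a_0\geq 0$, $a_1,\dots,a_k>0$ and $r>h_1>\cdots>h_k>0$. If $k=0$ set $b(\lambda)=0$; otherwise, with $h_0=r$, $$b(\lambda)=\sum_{t=1}^k(h_{t-1}-h_t)(a_t-1)+(h_k-1)(a_k-1).$$ *)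

(* Defs.v *)
From mathcomp Require Import all_boot all_order all_algebra.

Set Implicit Arguments.
Unset Strict Implicit.
Unset Printing Implicit Defensive.

Import Order.TTheory GRing.Theory Num.Theory.

(* The list lam'_1, ..., lam'_(lam_1), for lam listed in nonincreasing order. *)
Definition conj_part (lam : seq nat) : seq nat :=
  [seq count (fun l => j <= l) lam | j <- iota 1 (head 0 lam)].

(* h_1 > ... > h_k: as conj_part lam is nonincreasing, undup lists the distinct
   values in decreasing order.  The truncated subtractions in bconst are exact,
   since h_(t-1) > h_t >= 1 and a_t >= 1 for 1 <= t <= k. *)
Definition conj_heights (lam : seq nat) : seq nat :=
  undup [seq c <- conj_part lam | c < size lam].

Definition bconst (lam : seq nat) : nat :=
  let hs := conj_heights lam in
  let k := size hs in
  let h t := nth 0 (size lam :: hs) t in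
  let a t := count_mem (h t) (conj_part lam) in
  if k == 0 then 0
  else \sum_(1 <= t < k.+1) (h t.-1 - h t) * (a t - 1)
       + (h k - 1) * (a k - 1).

(* The ball (i, m) is the m-th of the d balls of weight w_i. *)
Definition ball (n d : nat) : finType := ('I_n * 'I_d)%type.

Definition bin_weight n d (w : n.-tuple nat) (A : {set ball n d}) : nat :=
  \sum_(x in A) tnth w x.1.

Definition feasible (n d : nat) (C : n.-tuple int) (w : n.-tuple nat) : Prop :=
  exists B : 'I_n -> {set ball n d},
    [/\ \bigcup_(i < n) B i = [set: ball n d],
        forall i j : 'I_n, i != j -> [disjoint B i & B j],
        forall i : 'I_n, #|B i| = d
      & forall i : 'I_n, ((bin_weight w (B i))%:Z <= tnth C i)%R].

(* Indices are 0-based: with i standing for the 1-based index i + 1, these are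
   C_(i+1) + ... + C_n and d (w_(i+1) + ... + w_n) + b((w_(i+1), ..., w_n)). *)
Definition tail_capacity n (C : n.-tuple int) (i : 'I_n) : int :=
  (\sum_(j < n | (i <= j)%N) tnth C j)%R.

Definition tail_bound n (d : nat) (w : n.-tuple nat) (i : 'I_n) : int :=
  (d * (\sum_(j < n | i <= j) tnth w j) + bconst (drop i w))%:Z.

Definition d_threshold n (w : n.-tuple nat) : nat :=
  n ^ 3 * head 0 w * (2 * n + head 0 w).

(* Main.v *)
Require Import Defs.
From mathcomp Require Import all_boot all_order all_algebra zify ring.

Set Implicit Arguments.
Unset Strict Implicit.
Unset Printing Implicit Defensive.

Import Order.TTheory GRing.Theory Num.Theory.

(* The constant [b] is a sum of terms [g_i - 1] over all bins but the first,
   where the gap [g_i] separates [w_i] from the next larger weight, or from the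
   next smaller one when [w_i] is the largest weight.

   By induction, the balls can be distributed so that every bin but the first
   respects its capacity.  Among such distributions, consider one maximizing a
   linear potential of the bin weights in which the first bin counts least.  If
   the first bin still overflows, then no other bin [i] has [g_i] units of room:
   otherwise exchanges that preserve all bin weights ([h - m] balls of weight
   [c] and [m - c] of weight [h] against [h - c] of weight [m]) would bring into
   bin [i], and into a bin of smaller potential, balls whose swap transfers
   weight [g_i] to bin [i].  Such exchanges exist because [d] is large and
   the bin weights are nearly sorted.  Summing the rooms contradicts the
   inequality on the total capacity.

   For sharpness, capacities exceeding [d w_i] by [g_i - 1] force each bin after
   [i0] to consist of its own balls, whence the capacity [d w_i0 - 1] of bin
   [i0] cannot be respected. *)

Local Open Scope ring_scope.

(** * Transports and weight-preserving exchanges *)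

Section Transports.

Variables (n : nat) (d : int).
Implicit Types (w z : 'I_n -> int) (x : 'I_n -> 'I_n -> int).

(* [x i a] is the number of balls of type [a] in bin [i]. *)
Definition transport x :=
  [/\ forall i a, 0 <= x i a, forall i, \sum_a x i a = d
    & forall a, \sum_i x i a = d].

Definition weight w x i := \sum_a x i a * w a.

(** Negative entries of [z] are balls going the other way, so that an exchange between bins [p] and
    [q] is one transfer, in which [p] receives [z]. *)
Definition transfer x p q z : 'I_n -> 'I_n -> int :=
  fun i a => x i a + ((i == p)%:R - (i == q)%:R) * z a.

Lemma sum_delta (a : 'I_n) (F : 'I_n -> int) :
  \sum_b (b == a)%:R * F b = F a.
Proof.
rewrite (bigD1 a) //= eqxx mul1r big1 ?addr0 // => b /negbTE ->.
by rewrite mul0r.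
Qed.

Lemma sum_le_const (P : pred 'I_n) (F : 'I_n -> int) (M : int) :
  0 <= M -> (forall a, P a -> F a <= M) -> \sum_(a | P a) F a <= n%:Z * M.
Proof.
move=> M0 FM; rewrite big_mkcond.
have -> : n%:Z * M = \sum_(a : 'I_n) M.
  by rewrite sumr_const card_ord -mulr_natl natz.
by apply: ler_sum => a _; case: ifP => // /FM.
Qed.

Lemma weight_transfer w x p q z i :
  weight w (transfer x p q z) i =
    weight w x i + ((i == p)%:R - (i == q)%:R) * \sum_a z a * w a.
Proof.
rewrite mulr_sumr -big_split; apply: eq_bigr => a _ /=.
by rewrite /transfer mulrDl mulrA.
Qed.

Lemma transfer_transport x p q z : transport x -> p != q ->
  \sum_a z a = 0 -> (forall a, 0 <= x p a + z a) ->
  (forall a, 0 <= x q a - z a) -> transport (transfer x p q z).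
Proof.
move=> [x0 xr xc] pq z0 zp zq; split.
- move=> i a; rewrite /transfer; case: (eqVneq i p) => [->|ip].
    by rewrite (negbTE pq) subr0 mul1r.
  case: (eqVneq i q) => [->|iq]; last by rewrite subrr mul0r addr0.
  by rewrite sub0r mulN1r.
- by move=> i; rewrite big_split /= -mulr_sumr z0 mulr0 addr0.
- move=> a; rewrite big_split /= -mulr_suml sumrB.
  have e r : \sum_(i < n) ((i == r)%:R : int) = 1.
    by under eq_bigr do rewrite -[_%:R]mulr1; rewrite sum_delta.
  by rewrite !e subrr mul0r addr0.
Qed.

(* [h - m] balls of type [c] and [m - c] balls of type [h] weigh as much as the
   same number of balls of type [m]. *)
Definition balance w c m h : 'I_n -> int := fun a =>
  (a == c)%:R * (w h - w m) + (a == h)%:R * (w m - w c)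
  - (a == m)%:R * (w h - w c).

Lemma balance_sum w c m h : \sum_a balance w c m h a = 0.
Proof.
rewrite sumrB big_split /= !sum_delta; ring.
Qed.

Lemma balance_weight w c m h : \sum_a balance w c m h a * w a = 0.
Proof.
under eq_bigr do rewrite /balance mulrBl mulrDl -!mulrA.
rewrite sumrB big_split /= !sum_delta; ring.
Qed.

Lemma balance_transport w x p q c m h : transport x -> p != q ->
  w c < w m -> w m < w h -> w h - w c <= x p m ->
  w h - w m <= x q c -> w m - w c <= x q h ->
  transport (transfer x p q (balance w c m h)).
Proof.
move=> tx pq cm mh xpm xqc xqh; have [x0 _ _] := tx.
have cm' : c != m by apply: contraTneq cm => ->; rewrite ltxx.
have mh' : m != h by apply: contraTneq mh => ->; rewrite ltxx.
have ch' : c != h by apply: contraTneq (lt_trans cm mh) => ->; rewrite ltxx.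
apply: transfer_transport => //; first exact: balance_sum.
- move=> a; rewrite /balance; have := x0 p a.
  case: (eqVneq a c) => [->|_]; first by rewrite (negbTE cm') (negbTE ch'); lia.
  case: (eqVneq a h) => [->|_]; first by rewrite eq_sym (negbTE mh'); lia.
  case: (eqVneq a m) => [->|_]; lia.
- move=> a; rewrite /balance; have := x0 q a.
  case: (eqVneq a c) => [->|_]; first by rewrite (negbTE cm') (negbTE ch'); lia.
  case: (eqVneq a h) => [->|_]; first by rewrite eq_sym (negbTE mh'); lia.
  case: (eqVneq a m) => [->|_]; lia.
Qed.

Lemma balance_transfer_weight w x p q c m h i :
  weight w (transfer x p q (balance w c m h)) i = weight w x i.
Proof. by rewrite weight_transfer balance_weight mulr0 addr0. Qed.

(** The last clause allows consecutive insertions: a ball already brought into another bin remains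
    available, provided its weight differs from [t]. *)
Definition inserted w x i t x' :=
  [/\ transport x', forall p, weight w x' p = weight w x p,
      exists2 a, w a = t & 0 < x' i a
    & forall j u, j != i -> w u != t -> 0 < x j u -> 0 < x' j u].

Lemma weight_shift w x i k : transport x ->
  \sum_a x i a * (w a - k) = weight w x i - d * k.
Proof.
move=> [_ xr _]; under eq_bigr do rewrite mulrBr.
by rewrite sumrB -mulr_suml xr mulrC.
Qed.

Lemma weight_opp w x i : weight (fun a => - w a) x i = - weight w x i.
Proof. by rewrite -sumrN; apply: eq_bigr => a _; rewrite mulrN. Qed.

(** Negating all weights exchanges the roles of heavier and lighter balls, so only one of two
    symmetric insertions has to be constructed. *)
Lemma inserted_opp w x i t x' :
  inserted (fun a => - w a) x i (- t) x' -> inserted w x i t x'.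
Proof.
move=> [tx wx [a wa xa] kx]; split=> //.
- by move=> p; have := wx p; rewrite !weight_opp => /oppr_inj.
- by exists a => //; apply: oppr_inj.
- by move=> j u ji ut; apply: kx; rewrite // eqr_opp.
Qed.

Lemma exists_many (P : pred 'I_n) (F : 'I_n -> int) (M : int) :
  0 <= M -> n%:Z * M < \sum_(a | P a) F a -> exists2 a, P a & M < F a.
Proof.
move=> M0 sF; apply/exists_inP; apply: contraLR sF.
rewrite negb_exists_in -leNgt => /forall_inP FM.
by apply: sum_le_const => // a /FM; rewrite leNgt.
Qed.

(** The bins of [A] hold [d] balls each, whereas the types outside [S] all lie in [A] without [i],
    and so provide at most [d] balls for each bin of [A] but one. *)
Lemma count_types_in_bins x (A S : pred 'I_n) i : transport x -> A i ->
  (forall a, (a == i) || ~~ A a -> S a) ->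
  d <= \sum_(q | A q) \sum_(a | S a) x q a.
Proof.
move=> [x0 xr xc] Ai AS.
have e1 : \sum_(q | A q) \sum_a x q a = \sum_(q | A q) d.
  by apply: eq_bigr.
have e2 : \sum_(q | A q) \sum_a x q a = \sum_(q | A q) \sum_(a | S a) x q a
    + \sum_(q | A q) \sum_(a | ~~ S a) x q a.
  by rewrite -big_split; apply: eq_bigr => q _; rewrite (bigID S).
have : \sum_(q | A q) \sum_(a | ~~ S a) x q a <= \sum_(a | A a && (a != i)) d.
  rewrite exchange_big /=.
  apply: (@le_trans _ _ (\sum_(a | ~~ S a) d)).
    apply: ler_sum => a _; rewrite -(xc a) big_mkcond.
    by apply: ler_sum => q _; case: ifP.
  rewrite big_mkcond [leRHS]big_mkcond; apply: ler_sum => a _.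
  have d0 : 0 <= d by rewrite -(xr i); apply: sumr_ge0.
  case: ifP => [nS|_]; last by case: ifP.
  case: ifP => // /negbT nA; suff : S a by rewrite (negbTE nS).
  by apply: AS; rewrite negb_and negbK orbC in nA.
have := e1; rewrite e2 [in X in _ = X](bigD1 i) /=; last by [].
by move/(canRL (addrK _)) => ->; rewrite -addrA lerDl subr_ge0.
Qed.

(* Bin [i] holds few balls heavier than [t].  Let [b] be its heaviest type
   present in quantity.  As the bins of [A] are not heavier than bin [i] and
   hold many balls of weight at least [t], one of them holds many balls lighter
   than [b] and many not lighter than [t]; mixing them with balls of types [b]
   and [t] brings the weight [t] into bin [i]. *)
Lemma insert_weight_from_below w x (D : int) i t (A : pred 'I_n) r t1 :
  1 <= D -> (forall a b, w a - w b <= D) -> transport x ->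
  (forall q, A q -> weight w x q <= weight w x i + D) ->
  d <= \sum_(q | A q) \sum_(a | t <= w a) x q a ->
  (forall a, t < w a -> x i a < D) -> (forall a, w a = t -> x i a = 0) ->
  w t1 = t -> D <= x r t1 ->
  n%:Z * (2 * n%:Z * D ^+ 2 + n%:Z * D + D) < d ->
  exists x', inserted w x i t x'.
Proof.
move=> D1 wD tx wA cA few none wt1 xr dbig; have [x0 xrow xcol] := tx.
set T := 2 * n%:Z * D ^+ 2 + n%:Z * D + D in dbig.
have n1 : 1 <= n%:Z by case: (i) => k; lia.
have nD1 : 1 <= n%:Z * D by nia.
have nDD1 : n%:Z * D <= n%:Z * D ^+ 2 by nia.
have nDT : n%:Z * D <= T by lia.
have nTT : n%:Z * D <= n%:Z * T by nia.
have ri : r != i by apply: contraTneq xr => ->; rewrite (none t1) //; lia.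
have [q Aq] : exists2 q, A q & T < \sum_(a | t <= w a) x q a.
  by apply: exists_many; [lia | apply: lt_le_trans cA].
move=> Nq.
have qi : q != i.
  apply: contraTneq Nq => ->; rewrite -leNgt.
  apply: (@le_trans _ _ (n%:Z * D)); last by [].
  apply: sum_le_const => [|a]; first lia.
  by rewrite le_eqVlt => /orP [/eqP/esym/none -> | /few/ltW //]; lia.
have [a0 _ a0D] : exists2 a, true & D - 1 < x i a.
  apply: exists_many; first lia.
  by rewrite xrow; apply: le_lt_trans dbig; lia.
have a0D' : D <= x i a0 by lia.
case: (@arg_maxP _ _ _ a0 (fun a => D <= x i a) w a0D') => b xb bmax.
have bt : w b < t.
  rewrite ltNge le_eqVlt; apply/negP => /orP [/eqP/esym/none xb0 | /few].
    by move: xb; rewrite xb0; lia.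
  by move: xb; lia.
have [s st xs] : exists2 s, t <= w s & D < x q s.
  by apply: exists_many; [lia | apply: le_lt_trans Nq; lia].
(* Otherwise compare with [d * w b]: the balls of weight at least [t] lift bin [q] above it by their
   number, up to an error [n D^2], while bin [i] exceeds it by at most [n D^2], as [b] is its
   heaviest type present in quantity. Bin [q] would then be too heavy for [wA]. *)
have [c cb xc] : exists2 c, w c < w b & D <= x q c.
  apply/exists_inP; apply: contraLR Nq.
  rewrite negb_exists_in -leNgt => /forall_inP nc.
  have lo : \sum_(a | t <= w a) x q a - n%:Z * D ^+ 2
      <= weight w x q - d * w b.
    rewrite -weight_shift // big_mkcond /=.
    have -> : n%:Z * D ^+ 2 = \sum_(a : 'I_n) D ^+ 2.
      by rewrite sumr_const card_ord -mulr_natl natz.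
    rewrite -sumrB; apply: ler_sum => a _.
    have := x0 q a; have := wD b a; have := nc a; rewrite -ltNge.
    by case: (lerP t (w a)); case: (ltP (w a) (w b)); nia.
  have hi : weight w x i - d * w b <= n%:Z * D ^+ 2.
    rewrite -weight_shift //; apply: sum_le_const => [|a _]; first nia.
    have := x0 i a; have := wD a b.
    have [/bmax h|h] := boolP (D <= x i a); last rewrite -ltNge in h; nia.
  have := wA q Aq; rewrite /T; nia.
clear T dbig nD1 nDD1 nDT nTT Nq wA cA few a0D a0D'.
(* Bin [i] gives balls of type [b] to bin [q] for balls of types [c] and [h], with [w h = t]. The
   intermediate [x1] allows for a preparatory exchange. *)
have insq h x1 : transport x1 -> (forall p, weight w x1 p = weight w x p) ->
    (forall j u, j != i -> w u != t -> 0 < x j u -> 0 < x1 j u) ->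
    w h = t -> x1 i b = x i b -> t - w b < x1 q c -> w b - w c < x1 q h ->
    0 <= x1 i h ->
    exists x', inserted w x i t x'.
  move=> tx1 wx1 kx1 wh x1b x1c x1h x1ih.
  have wtc := wD t1 c.
  exists (transfer x1 i q (balance w c b h)); split.
  - apply: balance_transport => //; rewrite ?wh ?x1b 1?eq_sym //; lia.
  - by move=> p; rewrite balance_transfer_weight.
  - exists h => //; rewrite /transfer /balance eqxx eq_sym (negbTE qi).
    have -> : (h == c) = false.
      by apply/eqP => e; move: bt cb; rewrite -wh e; lia.
    have -> : (h == b) = false by apply/eqP => e; move: bt; rewrite -wh e; lia.
    by rewrite eqxx; lia.
  - move=> j u ji ut /(kx1 j u ji ut); rewrite /transfer /balance (negbTE ji).
    case: (eqVneq j q) => [->|_]; last by lia.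
    have -> : (u == h) = false by apply/eqP => e; move: ut; rewrite e wh eqxx.
    have [->|uc] := eqVneq u c; last by case: eqP; lia.
    have -> : (c == b) = false by apply/eqP => e; move: cb; rewrite e; lia.
    rewrite wh; lia.
have wsc := wD s c; have wsb := wD s b.
have [wst|wst] := eqVneq (w s) t.
  by apply: (insq s x) => //; lia.
have ts : t < w s by rewrite lt_def wst.
have [rq|rq] := eqVneq r q.
  by rewrite rq in xr; apply: (insq t1 x) => //; lia.
have t1c : (t1 == c) = false by apply/eqP => e; move: wt1 bt cb; rewrite e; lia.
have t1s : (t1 == s) = false by apply/eqP => e; move: wt1 ts; rewrite e; lia.
have cs : (c == s) = false by apply/eqP => e; move: cb bt ts; rewrite e; lia.
(* Bin [q] may lack balls of weight [t]: it first obtains some from bin [r], against balls of types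
   [c] and [s]. *)
apply: (insq t1 (transfer x r q (balance w c t1 s))) => //.
- apply: balance_transport => //; rewrite ?wt1; lia.
- by move=> p; rewrite balance_transfer_weight.
- move=> j u ji ut; have := x0 j u; rewrite /transfer /balance wt1.
  have -> : (u == t1) = false by apply/eqP => e; move: ut; rewrite e wt1 eqxx.
  case: (eqVneq j q) => [->|_]; last first.
    rewrite subr0; case: (j == r); rewrite ?mul0r ?mul1r ?addr0 //.
    by case: (u == c); case: (u == s); rewrite /= ?mul0r ?mul1r; lia.
  rewrite eq_sym (negbTE rq).
  have [->|uc] := eqVneq u c; first by rewrite cs; lia.
  by case: eqP => [->|_]; rewrite /= ?mul0r ?mul1r; lia.
- by rewrite /transfer eq_sym (negbTE ri) eq_sym (negbTE qi); lia.
- rewrite /transfer /balance eqxx eq_sym (negbTE rq) eqxx cs eq_sym t1c wt1.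
  by lia.
- rewrite /transfer /balance eqxx eq_sym (negbTE rq) eqxx t1c t1s.
  have := x0 q t1; lia.
- have := x0 i t1; rewrite /transfer eq_sym (negbTE ri) eq_sym (negbTE qi).
  by lia.
Qed.

(** Bin [i] itself holds the heavier and the lighter balls of the balance, so one exchange with a
    bin rich in weight [t] is enough. *)
Lemma insert_weight_between w x (D : int) i t r t1 a c :
  (forall a b, w a - w b <= D) -> transport x ->
  w t1 = t -> r != i -> D <= x r t1 ->
  t < w a -> D <= x i a -> w c < t -> D <= x i c ->
  exists x', inserted w x i t x'.
Proof.
move=> wD tx wt1 ri xr ta xa ct xc; have [x0 _ _] := tx.
have t1c : (t1 == c) = false by apply/eqP => e; move: wt1 ct; rewrite e; lia.
have t1a : (t1 == a) = false by apply/eqP => e; move: wt1 ta; rewrite e; lia.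
have ac := wD a c.
exists (transfer x r i (balance w c t1 a)); split.
- apply: balance_transport => //; rewrite ?wt1; lia.
- by move=> p; rewrite balance_transfer_weight.
- exists t1 => //; rewrite /transfer /balance eq_sym (negbTE ri) !eqxx t1a t1c.
  by have := x0 i t1; lia.
- move=> j u ji ut; rewrite /transfer /balance (negbTE ji) wt1.
  have -> : (u == t1) = false by apply/eqP => e; move: ut; rewrite e wt1 eqxx.
  by case: (j == r); case: eqP; case: eqP; lia.
Qed.

(** If bin [i] holds many heavier and many lighter balls, these are exchanged directly. If it holds
    few heavier ones, the bins from [i] on serve as [A]; if few lighter ones, the bins up to [i] do,
    with all weights negated. *)
Lemma insert_own_weight w x (D : int) i :
  1 <= D -> (forall a b, w a - w b <= D) -> transport x ->
  (forall a b : 'I_n, (a <= b)%N -> w b <= w a) ->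
  (forall p q : 'I_n, (p <= q)%N -> weight w x q <= weight w x p + D) ->
  n%:Z * (2 * n%:Z * D ^+ 2 + n%:Z * D + D) < d ->
  exists x', inserted w x i (w i) x'.
Proof.
move=> D1 wD tx wmono near dbig; have [x0 xrow xcol] := tx.
have n1 : 1 <= n%:Z by case: (i) => k; lia.
have [/exists_inP [a /eqP wa xa]|] :=
    boolP [exists (a | w a == w i), 0 < x i a].
  by exists x; split => //; exists a.
rewrite negb_exists_in => /forall_inP none.
have {}none a : w a = w i -> x i a = 0.
  by move=> /eqP/none; have := x0 i a; lia.
have [r _ xr] : exists2 r, true & D < x r i.
  by apply: exists_many; [lia | rewrite xcol; nia].
have {}xr : D <= x r i by lia.
have ri : r != i by apply: contraTneq xr => ->; rewrite (none i) //; lia.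
have [/exists_inP [a wa xa]|] := boolP [exists (a | w i < w a), D <= x i a];
  last first.
  rewrite negb_exists_in => /forall_inP few.
  apply: (insert_weight_from_below (D := D) (A := fun q : 'I_n => (i <= q)%N)
    (t1 := i) (r := r)) => //.
  - by move=> q /near.
  - apply: (count_types_in_bins tx (i := i)) => // a /orP [/eqP -> //|].
    by rewrite -ltnNge => /ltnW/wmono.
  - by move=> a /few; rewrite -ltNge.
have [/exists_inP [c wc xc]|] := boolP [exists (a | w a < w i), D <= x i a].
  exact: (insert_weight_between wD tx (erefl _) ri xr wa xa wc xc).
rewrite negb_exists_in => /forall_inP few.
suff [x' ix'] : exists x', inserted (fun a => - w a) x i (- w i) x'.
  by exists x'; apply: inserted_opp.
apply: (insert_weight_from_below (D := D) (A := fun q : 'I_n => (q <= i)%N)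
  (t1 := i) (r := r)) => //.
- by move=> u v; have := wD v u; lia.
- by move=> q /near; rewrite !weight_opp; lia.
- apply: (count_types_in_bins tx (i := i)) => // u /orP [/eqP -> //|].
  by rewrite -ltnNge => /ltnW/wmono; lia.
- by move=> u; rewrite ltrN2 => /few; rewrite -ltNge.
- by move=> u /oppr_inj; apply: none.
Qed.

End Transports.

(** * Unloading the first bin *)

Section Ascent.

Variables (n : nat) (d D : int) (w C g : 'I_n.+1 -> int).
Implicit Types (x : 'I_n.+1 -> 'I_n.+1 -> int) (i j p q a b : 'I_n.+1).

Hypothesis w_noninc : forall a b, (a <= b)%N -> w b <= w a.
Hypothesis C_noninc : forall p q, (p <= q)%N -> C q <= C p.
Hypothesis w_ge0 : forall a, 0 <= w a.
Hypothesis w_leD : forall a, w a <= D.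
Hypothesis gap_top : forall i, i != ord0 -> w i = w ord0 ->
  exists k, [/\ w k < w ord0, forall a, w a < w ord0 -> w a <= w k
                & g i = w ord0 - w k].
Hypothesis gap_below : forall i, w i < w ord0 ->
  exists2 k, w i < w k & g i = w k - w i.
Hypothesis w_nonconst : exists a, w a < w ord0.
Hypothesis d_big :
  n.+1%:Z * (2 * n.+1%:Z * D ^+ 2 + n.+1%:Z * D + D) < d.

Lemma ord0_le i : (@ord0 n <= i)%N. Proof. exact: leq0n. Qed.

(* Improvements move weight to bins of larger key.  Bin 0 is to be unloaded; a
   bin [i] with [w i < w 0] takes heavier balls from bins of smaller index; any
   other bin takes balls from all bins but those of weight [w 0] before it. *)
Definition key i : int :=
  if i == ord0 then 0 else
  if w i == w ord0 then 2 * n.+1%:Z - (i : nat)%:Z else (i : nat)%:Z.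

Definition potential x := \sum_i key i * weight w x i.

Definition capped x := forall i, i != ord0 -> weight w x i <= C i.

Definition improvable x := exists x',
  [/\ transport d x', capped x' & potential x < potential x'].

Lemma key_ge0 i : 0 <= key i.
Proof.
rewrite /key; have := ltn_ord i; case: ifP => // _; case: ifP; lia.
Qed.

Lemma key_gt0 i : i != ord0 -> key ord0 < key i.
Proof.
rewrite /key eqxx => i0; rewrite (negbTE i0).
have : (0 < i)%N by rewrite lt0n.
have := ltn_ord i; case: ifP; lia.
Qed.

Lemma potential_transfer x p q z :
  potential (transfer x p q z) =
    potential x + (key p - key q) * \sum_a z a * w a.
Proof.
rewrite /potential; under eq_bigr do rewrite weight_transfer mulrDr mulrA.
rewrite big_split /= -mulr_suml; congr (_ + _ * _).
under eq_bigr do rewrite mulrBr ![key _ * _]mulrC.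
by rewrite sumrB !sum_delta.
Qed.

Lemma transfer_improves x p q z : transport d x -> capped x ->
  key q < key p -> \sum_a z a = 0 ->
  (forall a, 0 <= x p a + z a) -> (forall a, 0 <= x q a - z a) ->
  0 < \sum_a z a * w a <= C p - weight w x p -> improvable x.
Proof.
move=> tx cx qp z0 zp zq /andP [zw0 zwC].
have pq : p != q by apply: contraTneq qp => ->; rewrite ltxx.
exists (transfer x p q z); split.
- exact: transfer_transport.
- move=> i /cx wi; rewrite weight_transfer.
  case: (eqVneq i p) => [->|ip]; first by rewrite (negbTE pq) subr0 mul1r; lia.
  by case: (i == q); lia.
- by rewrite potential_transfer; nia.
Qed.

Lemma swap_improves x p q a b : transport d x -> capped x ->
  key q < key p -> 0 < x q a -> 0 < x p b -> w b < w a ->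
  w a - w b <= C p - weight w x p -> improvable x.
Proof.
move=> tx cx qp xa xb ba wC; have [x0 _ _] := tx.
have ab : (a == b) = false by apply/eqP => e; move: ba; rewrite e ltxx.
apply: (@transfer_improves x p q
  (fun u => (u == a)%:R * 1 - (u == b)%:R * 1)) => //.
- by rewrite sumrB !sum_delta.
- move=> u; have := x0 p u.
  by case: (eqVneq u b) => [->|_]; [rewrite eq_sym ab|case: (u == a)]; lia.
- move=> u; have := x0 q u.
  by case: (eqVneq u a) => [->|_]; [rewrite ab|case: (u == b)]; lia.
- under eq_bigr do rewrite mulrBl -!mulrA.
  by rewrite sumrB !sum_delta; lia.
Qed.

(** Exchanges may precede an improvement, since the potential depends on the bin weights only. *)
Lemma improvable_weight x x' :
  (forall p, weight w x' p = weight w x p) -> improvable x' -> improvable x.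
Proof.
move=> wx [x1 [tx cx px]]; exists x1; split => //.
apply: le_lt_trans px; rewrite /potential.
by under [leRHS]eq_bigr do rewrite wx.
Qed.

Lemma capped_weight x x' :
  (forall p, weight w x' p = weight w x p) -> capped x -> capped x'.
Proof. by move=> wx cx i /cx; rewrite wx. Qed.

Lemma D_ge1 : 1 <= D.
Proof.
by have [a a0] := w_nonconst; have := w_ge0 a; have := w_leD ord0; lia.
Qed.

Lemma spread_le a b : w a - w b <= D.
Proof. by have := w_ge0 b; have := w_leD a; lia. Qed.

(** * Improvements when the first bin overflows *)

Section Overloaded.

Variable x : 'I_n.+1 -> 'I_n.+1 -> int.
Hypotheses (tx : transport d x) (cx : capped x).
Hypothesis overload : C ord0 < weight w x ord0.

Lemma weight_const i k :
  (forall a, 0 < x i a -> w a = k) -> weight w x i = d * k.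
Proof.
have [x0 xrow _] := tx => wk; rewrite -(xrow i) mulr_suml.
apply: eq_bigr => a _; have := x0 i a; rewrite le_eqVlt => /orP [/eqP <-|].
  by rewrite !mul0r.
by move/wk ->.
Qed.

(** With [D] units of room, any swap of a ball of bin 0 for a lighter ball of bin [i] fits. If there
    is none, let [m] be the lightest type in bin [i]: bin 0 weighs at most [d * w m], bin [i] at
    least that, and [C i <= C ord0] contradicts the overload. *)
Lemma lightest_bin_improves i : i != ord0 -> D <= C i - weight w x i ->
  improvable x.
Proof.
move=> i0 Ci; have [x0 xrow _] := tx; have Ci0 := C_noninc (ord0_le i).
have [/existsP [a /existsP [b /and3P [xa xb ba]]]|] :=
    boolP [exists a, exists b, [&& 0 < x ord0 a, 0 < x i b & w b < w a]].
  apply: (swap_improves tx cx (key_gt0 i0) xa xb ba).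
  by apply: le_trans Ci; apply: spread_le.
rewrite negb_exists => /forallP nab; exfalso.
have {}nab a b : 0 < x ord0 a -> 0 < x i b -> w a <= w b.
  move=> xa xb; have := nab a; rewrite negb_exists => /forallP/(_ b).
  by rewrite xa xb /= -leNgt.
have [b xb] : exists b, 0 < x i b.
  apply/existsP; have := D_ge1; apply: contraLR; rewrite negb_exists.
  move=> /forallP xi; suff : d <= 0 by have := d_big; have := w_leD ord0; nia.
  by rewrite -(xrow i); apply: sumr_le0 => a _; rewrite leNgt.
case: (@arg_minP _ _ _ b (fun a => 0 < x i a) w xb) => m xm mmin.
have := weight_shift w i (w m) tx; have := weight_shift w ord0 (w m) tx.
have : \sum_a x ord0 a * (w a - w m) <= 0.
  apply: sumr_le0 => a _; have := x0 ord0 a; rewrite le_eqVlt.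
  move=> /orP [/eqP <-|xa]; first by rewrite mul0r.
  by have := nab a m xa xm; nia.
have : 0 <= \sum_a x i a * (w a - w m).
  apply: sumr_ge0 => a _; have := x0 i a; rewrite le_eqVlt.
  move=> /orP [/eqP <-|xa]; first by rewrite mul0r.
  by have /= := mmin a xa; nia.
have := D_ge1; lia.
Qed.

Hypothesis tight : forall i, i != ord0 -> C i - weight w x i < D.

(** Capacities are nonincreasing; bins after the first are filled to less than [D] below them, and
    the first one beyond its capacity. *)
Lemma near_sorted p q : (p <= q)%N -> weight w x q <= weight w x p + D.
Proof.
move=> pq; have D1 := D_ge1.
have [qe|q0] := eqVneq q ord0.
  have -> : p = q by apply: val_inj; move: pq; rewrite qe leqn0 => /eqP.
  lia.
have Cq := cx q0; have Cpq := C_noninc pq.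
have [->|p0] := eqVneq p ord0; first by have := C_noninc (ord0_le q); lia.
by have := tight p0; lia.
Qed.

Lemma gap_below_improves i : i != ord0 -> w i < w ord0 ->
  g i <= C i - weight w x i -> improvable x.
Proof.
move=> i0 wi gC; have [k wk gk] := gap_below wi.
(* A bin of smaller key with own weight [w k]: bin 0 if that weight is the largest, and otherwise
   bin [k], which precedes [i]. *)
have [j [wj ji]] : exists j, w j = w k /\ key j < key i.
  have [->|wk0] := eqVneq (w k) (w ord0).
    by exists ord0; split => //; apply: key_gt0.
  exists k; split => //; rewrite /key (negbTE i0) (negbTE wk0).
  rewrite [w i == _]lt_eqF // (_ : k == ord0 = false); last first.
    by apply/eqP => e; rewrite e eqxx in wk0.
  by rewrite ltz_nat ltnNge; apply/negP => /w_noninc; lia.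
have ij : i != j by apply: contraTneq ji => ->; rewrite ltxx.
(* Bins [j] and [i] receive balls of their own weights, whose swap brings [g i] units to bin [i];
   the second insertion keeps the ball of bin [j]. *)
have [x1 [tx1 wx1 [a wa xa] _]] :=
  insert_own_weight j D_ge1 spread_le tx w_noninc near_sorted d_big.
have near1 p q : (p <= q)%N -> weight w x1 q <= weight w x1 p + D.
  by rewrite !wx1; apply: near_sorted.
have [x2 [tx2 wx2 [b wb xb] kx2]] :=
  insert_own_weight i D_ge1 spread_le tx1 w_noninc near1 d_big.
have wx p : weight w x2 p = weight w x p by rewrite wx2.
apply: (improvable_weight wx).
apply: (swap_improves (a := a) tx2 (capped_weight wx cx) ji _ xb).
- by apply: kx2 => //; [rewrite eq_sym | rewrite wa wj gt_eqF].
- by rewrite wb wa wj.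
- by rewrite wx wa wb wj -gk.
Qed.

(** * Bins after the first whose own weight is the largest *)

Section TopBin.

Variables i k : 'I_n.+1.
Hypotheses (i0 : i != ord0) (wi : w i = w ord0).
Hypotheses (wk : w k < w ord0) (wkmax : forall a, w a < w ord0 -> w a <= w k).
Hypothesis gC : w ord0 - w k <= C i - weight w x i.

(** After a heaviest ball is inserted into bin 0, swapping it with the ball of weight [w k]
    transfers [w ord0 - w k], which fits by [gC]. *)
Lemma top_bin_inserted x1 : inserted d w x i (w k) x1 -> improvable x.
Proof.
move=> [tx1 wx1 [b wb xb] _].
have near1 p q : (p <= q)%N -> weight w x1 q <= weight w x1 p + D.
  by rewrite !wx1; apply: near_sorted.
have [x2 [tx2 wx2 [a wa xa] kx2]] :=
  insert_own_weight ord0 D_ge1 spread_le tx1 w_noninc near1 d_big.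
have wx p : weight w x2 p = weight w x p by rewrite wx2.
apply: (improvable_weight wx).
apply: (swap_improves (b := b) tx2 (capped_weight wx cx) (key_gt0 i0) xa).
- by apply: kx2 => //; rewrite wb lt_eqF.
- by rewrite wb wa.
- by rewrite wx wa wb.
Qed.

(* Bin [i] consists almost only of the heaviest balls: replacing one ball [c]
   lighter than [w k] together with [m] heaviest balls by [m + 1] balls of type
   [k] increases its weight by an amount in [1, w 0 - w k]. *)
Lemma nearly_full_top_bin_improves :
  (forall a, w a = w k -> x i a = 0) -> (forall a, w a < w k -> x i a < D) ->
  improvable x.
Proof.
move=> none few; have [x0 xrow xcol] := tx; have D1 := D_ge1.
have big := d_big; set N := n.+1%:Z in big; have N1 : 1 <= N by rewrite /N; lia.
have ND : N * D < d by nia.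
(* Bin [j] holds at least the average number [d / N] of balls of type [k]. *)
have [j _ xj] : exists2 j, true & d <= N * x j k.
  apply/exists_inP; have := ltxx d; apply: contraFT.
  rewrite negb_exists_in => /forall_inP small.
  rewrite -(ltr_pM2l (_ : 0 < N)); last by lia.
  rewrite -{1}(xcol k) mulr_sumr.
  apply: (@lt_le_trans _ _ (\sum_(j < n.+1) d)); last first.
    by rewrite sumr_const card_ord -mulr_natl natz.
  apply: ltr_sum; first by apply/hasP; exists ord0; rewrite // mem_index_enum.
  by move=> j _; have := small j isT; rewrite ltNge.
have xjD : D < x j k by nia.
have ij : i != j.
  by apply: contraTneq xjD => <-; rewrite none //; lia.
have heavy a : 0 < x i a -> w a < w ord0 -> w a < w k.
  move=> xa /wkmax; rewrite le_eqVlt => /orP [/eqP/none e|//].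
  by rewrite e in xa.
have ji : key j < key i.
  rewrite /key (negbTE i0) wi eqxx.
  have ltn_i := ltn_ord i; have ltn_j := ltn_ord j.
  case: eqP => [_|_]; first lia.
  case: eqP => [wj|_]; last by move: ltn_i ltn_j => /=; lia.
  suff : (i < j)%N by lia.
  (* If [j] preceded [i], near sortedness would fail: bin [i] is within [N D^2] of the maximum
     [d * w ord0], whereas bin [j] falls short of it by at least [x j k >= d / N]. *)
  rewrite ltn_neqAle ij /=; apply: contraT; rewrite -ltnNge => /ltnW ji.
  have := near_sorted ji.
  have := weight_shift w i (w ord0) tx; have := weight_shift w j (w ord0) tx.
  have : - \sum_a x i a * (w a - w ord0) <= N * D ^+ 2.
    rewrite -sumrN; apply: sum_le_const => [|a _]; first nia.
    have := x0 i a; rewrite le_eqVlt => /orP [/eqP <-|xa].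
      by rewrite mul0r; nia.
    have := w_noninc (ord0_le a); rewrite le_eqVlt => /orP [/eqP ->|wa].
      by rewrite subrr mulr0; nia.
    by have := few a (heavy a xa wa); have := spread_le ord0 a; nia.
  have : \sum_a x j a * (w a - w ord0) <= - x j k.
    rewrite (bigD1 k) //=.
    have : \sum_(a < n.+1 | a != k) x j a * (w a - w ord0) <= 0.
      apply: sumr_le0 => a _; have := w_noninc (ord0_le a).
      by have := x0 j a; nia.
    by move: (\sum_(_ < _ | _) _) => S; move: xjD wk D1; clear; nia.
  move: (\sum_a _) (\sum_a _) => S1 S2.
  by move: xj N1 D1 d_big; rewrite -/N; clear; nia.
(* Otherwise bin [i] has the maximal weight [d * w ord0], so bin 0 weighs no more, and
   [C i <= C ord0] contradicts the overload. *)
have [c wc xc] : exists2 c, w c < w k & 0 < x i c.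
  apply/exists_inP; have := overload; apply: contraLR.
  rewrite negb_exists_in => /forall_inP noc.
  rewrite -leNgt; apply: le_trans (C_noninc (ord0_le i)).
  apply: le_trans (cx i0); rewrite (@weight_const i (w ord0)).
    rewrite -(xrow ord0) mulr_suml; apply: ler_sum => a _.
    by have := w_noninc (ord0_le a); have := x0 ord0 a; nia.
  move=> a xa; have := w_noninc (ord0_le a).
  rewrite le_eqVlt => /orP [/eqP //|wa].
  by have := noc a (heavy a xa wa); rewrite xa.
have [h _ xh] : exists2 h, true & D < x i h.
  by apply: exists_many; [lia | rewrite xrow].
have wh : w h = w ord0.
  have := w_noninc (ord0_le h); rewrite le_eqVlt => /orP [/eqP //|wa].
  have xh0 : 0 < x i h by lia.
  by have := few h (heavy h xh0 wa); lia.
(* [m] is the quotient of [w k - w c - 1] by [w ord0 - w k]; the subtracted 1 makes the gain range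
   from 1 to [w ord0 - w k] instead of starting at 0. *)
have [m [m0 mD m1 mg]] : exists m : int, [/\ 0 <= m, m < D,
    1 <= (w k - w c) - m * (w ord0 - w k)
    & (w k - w c) - m * (w ord0 - w k) <= w ord0 - w k].
  have := divz_eq (w k - w c - 1) (w ord0 - w k).
  have /= : (0 <= (w k - w c - 1) %% (w ord0 - w k))%Z.
    by apply: modz_ge0; lia.
  have : ((w k - w c - 1) %% (w ord0 - w k) < w ord0 - w k)%Z.
    by apply: ltz_pmod; lia.
  have := divz_ge0 (w k - w c - 1) (_ : 0 < w ord0 - w k).
  move: (divz _ _) (modz _ _) => m r /(_ ltac:(lia)) m0 r1 r0 e.
  have m_ge0 : 0 <= m by rewrite m0; lia.
  have kcD := spread_le k c.
  exists m; split => //; [|lia|lia].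
  by move: m_ge0 r0 e wk kcD; clear; nia.
have kc : (k == c) = false by apply/eqP => e; move: wc; rewrite e ltxx.
have kh : (k == h) = false by apply/eqP => e; move: wk; rewrite e wh ltxx.
have ch : (c == h) = false.
  by apply/eqP => e; move: wc; rewrite e wh; lia.
apply: (@transfer_improves x i j
  (fun u => (u == k)%:R * (m + 1) - (u == c)%:R * 1 - (u == h)%:R * m)) => //.
- by rewrite !sumrB !sum_delta; lia.
- move=> u; have := x0 i u.
  have [->|_] := eqVneq u k; first by rewrite kc kh; lia.
  have [->|_] := eqVneq u c; first by rewrite ch; lia.
  by have [->|_] := eqVneq u h; lia.
- move=> u; have := x0 j u.
  have [->|_] := eqVneq u k; first by rewrite kc kh; lia.
  have [->|_] := eqVneq u c; first by rewrite ch; lia.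
  by have [->|_] := eqVneq u h; lia.
- under eq_bigr do rewrite !mulrBl -!mulrA.
  by rewrite !sumrB !sum_delta wh; lia.
Qed.

(** Unless weight [w k] is already present or lighter balls are few, it can be inserted: directly
    between heavier and lighter balls, or from below with the bins from [i] on as [A], the types up
    to [i] all having the largest weight. *)
Lemma top_bin_improves : improvable x.
Proof.
have [x0 xrow xcol] := tx; have D1 := D_ge1.
have [/exists_inP [a /eqP wa xa]|] :=
    boolP [exists (a | w a == w k), 0 < x i a].
  by apply: (@top_bin_inserted x); split => //; exists a.
rewrite negb_exists_in => /forall_inP none.
have {}none a : w a = w k -> x i a = 0.
  by move=> /eqP/none; have := x0 i a; lia.
have [/exists_inP [c wc xc]|] := boolP [exists (a | w a < w k), D <= x i a];
  last first.
  rewrite negb_exists_in => /forall_inP few.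
  by apply: nearly_full_top_bin_improves => // a /few; rewrite -ltNge.
have [r _ xr] : exists2 r, true & D < x r k.
  by apply: exists_many; [lia | rewrite xcol; nia].
have {}xr : D <= x r k by lia.
have ri : r != i by apply: contraTneq xr => ->; rewrite (none k) //; lia.
have [/exists_inP [a wa xa]|] := boolP [exists (a | w k < w a), D <= x i a].
  have [x1 ix1] :=
    insert_weight_between spread_le tx (erefl _) ri xr wa xa wc xc.
  exact: top_bin_inserted ix1.
rewrite negb_exists_in => /forall_inP few.
suff [x1 /top_bin_inserted //] : exists x1, inserted d w x i (w k) x1.
apply: (insert_weight_from_below (D := D) (A := fun q : 'I_n.+1 => (i <= q)%N)
  (t1 := k) (r := r)) => //.
- exact: spread_le.
- by move=> q /near_sorted.
- apply: (count_types_in_bins tx (i := i)) => // a ai.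
  have {}ai : (a <= i)%N.
    by case/orP: ai => [/eqP -> //|]; rewrite -ltnNge => /ltnW.
  by have := w_noninc ai; lia.
- by move=> a /few; rewrite -ltNge.
Qed.

End TopBin.

End Overloaded.

(** * Total capacity and termination of the improvements *)

Hypothesis C_total :
  d * (\sum_i w i) + \sum_(i | i != ord0) (g i - 1) <= \sum_i C i.

Lemma total_weight x : transport d x ->
  \sum_i weight w x i = d * \sum_i w i.
Proof.
move=> [_ _ xcol]; rewrite exchange_big /= mulr_sumr; apply: eq_bigr => a _.
by rewrite -mulr_suml xcol.
Qed.

Lemma overloaded_improvable x : transport d x -> capped x ->
  C ord0 < weight w x ord0 -> improvable x.
Proof.
move=> tx cx ov.
have [/exists_inP [i i0 Ci]|] :=
    boolP [exists (i | i != ord0), D <= C i - weight w x i].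
  exact: lightest_bin_improves Ci.
rewrite negb_exists_in => /forall_inP tight.
have {}tight i : i != ord0 -> C i - weight w x i < D.
  by move=> /tight; rewrite -ltNge.
have [/exists_inP [i i0 Ci]|] :=
    boolP [exists (i | i != ord0), g i <= C i - weight w x i].
  have := w_noninc (ord0_le i); rewrite le_eqVlt => /orP [/eqP wi|wi].
    have [k [wk wkmax gk]] := gap_top i0 wi; rewrite gk in Ci.
    exact: (top_bin_improves tx cx ov tight i0 wi wk wkmax Ci).
  exact: (gap_below_improves tx cx ov tight i0 wi Ci).
rewrite negb_exists_in => /forall_inP gC; exfalso.
have tw := total_weight tx; move: C_total.
rewrite -tw (bigD1 ord0) //= [X in _ <= X](bigD1 ord0) //= => h.
have : \sum_(i | i != ord0) C i
    <= \sum_(i | i != ord0) weight w x i + \sum_(i | i != ord0) (g i - 1).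
  rewrite -big_split; apply: ler_sum => i /gC; rewrite /=; lia.
by move=> /(ltr_leD ov); rewrite addrA ltNge h.
Qed.

Lemma potential_le x : transport d x ->
  potential x <= \sum_i key i * (d * D).
Proof.
move=> [x0 xrow _]; apply: ler_sum => i _.
apply: ler_wpM2l; first exact: key_ge0.
rewrite -(xrow i) mulr_suml; apply: ler_sum => a _.
by apply: ler_wpM2l => //; apply: w_leD.
Qed.

(** The potential is a bounded integer, so the improvements end, and they can only end once bin 0
    respects its capacity. *)
Lemma capped_transport_completes x : transport d x -> capped x ->
  exists2 x', transport d x' & forall i, weight w x' i <= C i.
Proof.
set M := \sum_i key i * (d * D).
have [m] := ubnP `|M - potential x|%N.
elim: m x => // m IH x xm tx cx.
have [C0|C0] := lerP (weight w x ord0) (C ord0).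
  by exists x => // i; have [-> //|/cx] := eqVneq i ord0.
have [x' [tx' cx' px']] := overloaded_improvable tx cx C0.
apply: (IH x') => //; have := potential_le tx'; rewrite -/M; lia.
Qed.

End Ascent.

(** * The constant b as a sum of gaps *)

Section Gaps.

Local Open Scope nat_scope.

Lemma geq_trans : transitive geq.
Proof. by move=> a b c ab bc; apply: leq_trans bc ab. Qed.

Lemma gtn_trans : transitive gtn.
Proof. by move=> a b c ab bc; apply: ltn_trans bc ab. Qed.

Definition count_ge (lam : seq nat) j := count (fun l => j <= l) lam.

(** Both sides say that the Young diagram has a box in row [p] and column [j], rows being counted
    from 0 and columns from 1. *)
Lemma leq_nth_count_ge lam j p : sorted geq lam -> p < size lam ->
  (j <= nth 0 lam p) = (p < count_ge lam j).
Proof.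
rewrite /count_ge; elim: lam p => //= x s IH p xs ps.
have [jx|xj] := leqP j x.
  by case: p ps => [|p] //= ps; rewrite IH ?(path_sorted xs).
have -> : count (fun l => j <= l) s = 0.
  apply/eqP; rewrite -leqn0 leqNgt -has_count; apply/hasPn => l ls.
  by have /allP/(_ l ls) /= := order_path_min geq_trans xs; lia.
case: p ps => [|p] /= ps; first by lia.
have /allP/(_ (nth 0 s p)) /= := order_path_min geq_trans xs.
by rewrite mem_nth //; lia.
Qed.

Lemma conj_heightsP lam c : reflect
  (exists2 j, 1 <= j <= head 0 lam
     & c = count_ge lam j /\ count_ge lam j < size lam)
  (c \in conj_heights lam).
Proof.
rewrite /conj_heights mem_undup mem_filter; apply: (iffP andP).
  move=> [cs /mapP [j]]; rewrite mem_iota => jV e.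
  by exists j; [lia | rewrite /count_ge -e].
move=> [j jV [-> cs]]; split => //; apply/mapP; exists j => //.
by rewrite mem_iota; lia.
Qed.

Variable lam : seq nat.
Hypothesis lam_sorted : sorted geq lam.

Let V := head 0 lam.
Let y p := nth 0 lam p.
Let cnt := count_ge lam.

Lemma nth_noninc p q : p <= q -> q < size lam -> y q <= y p.
Proof.
move=> pq ql; apply: (sorted_leq_nth geq_trans leqnn 0 lam_sorted) => //.
by rewrite inE (leq_ltn_trans pq).
Qed.

Lemma nth_le_head p : y p <= V.
Proof.
have [ps|ps] := ltnP p (size lam); last by rewrite /y nth_default.
by rewrite /V -nth0; apply: nth_noninc.
Qed.

Lemma count_ge_noninc j k : j <= k -> cnt k <= cnt j.
Proof. by move=> jk; apply: sub_count => l /=; apply: leq_trans. Qed.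

Lemma count_ge_decreasing j k z : z \in lam -> j <= z < k -> cnt k < cnt j.
Proof.
move=> zl /andP [jz zk].
have := count_predUI (fun l => k <= l) (pred1 z) lam.
rewrite (eq_count (a2 := pred0) (a1 := predI _ _)); last first.
  by move=> l /=; case: eqP => [->|_]; rewrite ?andbF // leqNgt zk.
rewrite count_pred0 addn0 -/(count_ge lam k).
have : 0 < count_mem z lam by rewrite -has_count has_pred1.
have : count (predU (fun l => k <= l) (pred1 z)) lam <= cnt j.
  by apply: sub_count => l /= /orP [|/eqP ->] //; lia.
by move=> le_j c0 e; apply: leq_trans le_j; rewrite e -addn1 leq_add2l.
Qed.

(** [u] and [v] are consecutive parts, so the column heights agree for [v < j <= u]; on either side
    the part [v] or [u] makes the height change strictly. *)
Lemma count_mem_conj_part u v : u \in lam -> v \in lam -> v < u ->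
  (forall z, z \in lam -> v < z -> u <= z) ->
  count_mem (cnt v.+1) (conj_part lam) = u - v.
Proof.
move=> ul vl vu uv; rewrite /conj_part count_map -/V.
have uV : u <= V by move: ul => /(nthP 0) [p _ <-]; apply: nth_le_head.
have -> : V = v + ((u - v) + (V - u)) by lia.
rewrite !iotaD !count_cat.
rewrite (eq_in_count (a2 := pred0)); last first.
  move=> j; rewrite mem_iota /= => jv; apply/eqP.
  by have := @count_ge_decreasing j v.+1 v vl; rewrite /cnt /count_ge; lia.
rewrite [X in _ + (X + _)](eq_in_count (a2 := predT)); last first.
  move=> j; rewrite mem_iota /= => jv; apply/eqP; apply: eq_in_count => z zl.
  by have := uv z zl; lia.
rewrite [X in _ + (_ + X)](eq_in_count (a2 := pred0)); last first.
  move=> j; rewrite mem_iota /= => jv; apply/eqP.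
  by have := @count_ge_decreasing v.+1 j u ul; rewrite /cnt /count_ge; lia.
by rewrite !count_pred0 count_predT size_iota; lia.
Qed.

Lemma next_value p : p < size lam -> y p < V ->
  exists k, [/\ k < size lam, y p < y k &
    forall z, z \in lam -> y p < z -> y k <= z].
Proof.
move=> ps yV; have s0 : 0 < size lam by lia.
have c0 : 0 < cnt (y p).+1.
  by rewrite -(leq_nth_count_ge _ lam_sorted) // nth0.
have cs : cnt (y p).+1 <= size lam by apply: count_size.
have ck : (cnt (y p).+1).-1 < size lam by lia.
(* The entries exceeding [y p] come first, and the last of them is the smallest. *)
exists (cnt (y p).+1).-1; split=> //.
  by rewrite (leq_nth_count_ge _ lam_sorted) // -/cnt; lia.
move=> z /(nthP 0) [q qs <-]; rewrite (leq_nth_count_ge _ lam_sorted) //.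
by move=> qc; apply: nth_noninc => //; rewrite -ltnS prednK.
Qed.

Hypothesis nonconst : last 0 lam < V.

Lemma size_gt0 : 0 < size lam.
Proof.
rewrite lt0n; apply: contraTneq nonconst => /size0nil; rewrite /V => ->.
by rewrite ltnn.
Qed.

Lemma last_nth_pred : last 0 lam = y (size lam).-1.
Proof. by rewrite /y nth_last. Qed.

Lemma count_top_lt : cnt V < size lam.
Proof.
have s0 := size_gt0.
have := @leq_nth_count_ge lam V (size lam).-1 lam_sorted.
by rewrite -/cnt -/(y _) -last_nth_pred; lia.
Qed.

Lemma count_top_gt0 : 0 < cnt V.
Proof. by rewrite -(leq_nth_count_ge _ lam_sorted) ?size_gt0 // nth0. Qed.

Let hs := size lam :: conj_heights lam.
Let h t := nth 0 hs t.
Let k := size (conj_heights lam).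

Lemma heights_sorted : sorted gtn hs.
Proof.
rewrite /hs /= path_sortedE; last exact: gtn_trans.
apply/andP; split; first by apply/allP => c /conj_heightsP [j _ [->]].
rewrite gtn_sorted_uniq_geq undup_uniq /=.
apply: (subseq_sorted geq_trans (undup_subseq _)).
apply: (subseq_sorted geq_trans (filter_subseq _ _)).
apply: (@homo_sorted _ _ cnt leq geq); last exact: iota_sorted.
by move=> i j; apply: count_ge_noninc.
Qed.

Lemma height_decreasing s t : s < t <= k -> h t < h s.
Proof.
move=> st; apply: (sorted_ltn_nth gtn_trans 0 heights_sorted);
  rewrite ?inE /= -/k; lia.
Qed.

Lemma heightP c : c \in conj_heights lam -> exists2 s, 1 <= s <= k & c = h s.
Proof.
by move=> /(nthP 0) [s sk <-]; exists s.+1.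
Qed.

Lemma height_in t : 1 <= t <= k -> h t \in conj_heights lam.
Proof. by case: t => // t tk; rewrite /h /=; apply: mem_nth. Qed.

(* The column of position [p]: its multiplicity in the conjugate partition is
   the gap separating [y p] from the next larger part, or, when [y p] is the
   largest part, from the next smaller one. *)
Let g p := count_mem (if y p < V then cnt (y p).+1 else cnt V) (conj_part lam).

(** The number of parts exceeding [y p] is a height at most [p < h t.-1], hence at most [h t].
    Conversely, [h t] counts the parts that reach some [j > y p], so it is no larger. *)
Lemma column_height t p : 1 <= t <= k -> h t <= p < h t.-1 ->
  y p < V /\ cnt (y p).+1 = h t.
Proof.
move=> tk tp; have /conj_heightsP [j] := height_in tk.
rewrite -/V -/cnt => jV [htj js].
have ps : p < size lam.
  have [t1|t1] := leqP t 1.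
    have e : t = 1 by lia.
    by move: tp; rewrite e => /andP [].
  have : h t.-1 < h 0 by apply: height_decreasing; lia.
  by case/andP: tp => _; apply: ltn_trans.
have yj : y p < j.
  by rewrite ltnNge (leq_nth_count_ge _ lam_sorted) // -/cnt; lia.
have yV : y p < V by lia.
split=> //; apply/eqP; rewrite eqn_leq; apply/andP; split; last first.
  by rewrite htj; apply: count_ge_noninc.
have cp : cnt (y p).+1 <= p.
  by rewrite leqNgt -(leq_nth_count_ge _ lam_sorted) // ltnn.
have /heightP [s sk hs_] : cnt (y p).+1 \in conj_heights lam.
  apply/conj_heightsP; exists (y p).+1; rewrite -/V -/cnt //.
  by split=> //; lia.
rewrite hs_; have [st|ts] := ltnP s t.
  have [st'|st'] := ltnP s t.-1.
    by have := @height_decreasing s t.-1; lia.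
  have e : s = t.-1 by lia.
  by move: cp; rewrite hs_ e; lia.
move: ts; rewrite leq_eqVlt => /orP [/eqP -> //|ts].
by apply/ltnW/height_decreasing; lia.
Qed.

(** Column heights are nonincreasing, so the smallest is that of the last column [V]; it is below
    [size lam] since the last part is below [V]. *)
Lemma last_height : 1 <= k /\ h k = cnt V.
Proof.
have V1 : 1 <= V by lia.
have /heightP [s sk e] : cnt V \in conj_heights lam.
  apply/conj_heightsP; exists V; first by rewrite -/V; lia.
  by split=> //; apply: count_top_lt.
have k1 : 1 <= k by lia.
split=> //; apply/eqP; rewrite eqn_leq; apply/andP; split.
  have [sk'|sk'] := eqVneq s k; first by rewrite e sk'.
  by rewrite e; apply/ltnW/height_decreasing; lia.
have /conj_heightsP [j] := @height_in k ltac:(lia).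
by rewrite -/V -/cnt => jV [-> _]; apply: count_ge_noninc; lia.
Qed.

(** The term of index [t] collects the positions [p] with [h t <= p < h t.-1], whose gaps all equal
    [a t]; the last term collects the copies of the largest part except position 0. *)
Lemma bconst_sum_gaps : bconst lam = \sum_(1 <= p < size lam) (g p - 1).
Proof.
have [k1 hk] := last_height.
rewrite /bconst -/k -/hs.
have -> : k == 0 = false by lia.
have c0 := count_top_gt0.
rewrite [RHS](@big_cat_nat _ _ _ (h k)) /=;
  try by rewrite hk; have := count_top_lt; lia.
rewrite addnC; congr (_ + _).
  rewrite -sum_nat_const_nat; apply: eq_big_nat => p.
  rewrite -/(h k) hk => pk; have ct := count_top_lt.
  rewrite /g; have -> : y p < V = false.
    apply/negbTE; rewrite -leqNgt (leq_nth_count_ge _ lam_sorted) -/cnt.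
      by lia.
    by lia.
  by [].
have -> : size lam = h 0 by [].
suff sum_upto m : m <= k ->
    \sum_(1 <= t < m.+1) (h t.-1 - h t) * (count_mem (h t) (conj_part lam) - 1)
    = \sum_(h m <= p < h 0) (g p - 1) by apply: sum_upto.
elim: m => [|m IH] mk.
  by rewrite !big_geq.
rewrite big_nat_recr //= IH; last by lia.
have hm : h m.+1 <= h m by apply/ltnW/height_decreasing; lia.
have hm0 : h m <= h 0.
  by case: m {IH hm} mk => // m mk; apply/ltnW/height_decreasing; lia.
rewrite (@big_cat_nat _ _ _ (h m) (h m.+1)) //= addnC; congr (_ + _).
rewrite -sum_nat_const_nat; apply: eq_big_nat => p pm.
by rewrite /g; have [-> ->] := @column_height m.+1 p ltac:(lia) pm.
Qed.

Lemma gap_below_top p : p < size lam -> y p < V ->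
  exists q, [/\ q < size lam, y p < y q, g p = y q - y p &
    forall z, z \in lam -> y p < z -> y q <= z].
Proof.
move=> ps yV; have [q [qs pq qmin]] := next_value ps yV.
exists q; split=> //; rewrite /g yV.
by apply: count_mem_conj_part; rewrite ?mem_nth.
Qed.

Lemma gap_of_top p : y p = V ->
  exists q, [/\ q < size lam, y q < V, g p = V - y q &
    forall r, r < size lam -> y r < V -> y r <= y q].
Proof.
move=> yV; have ql := count_top_lt; set q := cnt V in ql *.
have qV : y q < V by rewrite ltnNge (leq_nth_count_ge _ lam_sorted) // ltnn.
have below r : r < size lam -> y r < V -> y r <= y q.
  move=> rs; rewrite ltnNge (leq_nth_count_ge _ lam_sorted) // -leqNgt => qr.
  exact: nth_noninc.
exists q; split=> //; rewrite /g yV ltnn.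
(* No part lies strictly between [y q] and [V]. *)
have -> : cnt V = cnt (y q).+1.
  apply: eq_in_count => z /(nthP 0) [r rs <-].
  have := below r rs; have := nth_le_head r; rewrite -/(y r); move: qV.
  by clear; move: (y r) (y q) V => a b c; lia.
apply: count_mem_conj_part => //; rewrite ?mem_nth //.
  by rewrite /V -nth0 mem_nth ?size_gt0.
move=> z /(nthP 0) [r rs <-].
have := below r rs; have := nth_le_head r; rewrite -/(y r); move: qV.
by clear; move: (y r) (y q) V => a b c; lia.
Qed.

Lemma bconst_gaps : exists g : nat -> nat,
  [/\ bconst lam = \sum_(1 <= p < size lam) (g p - 1),
      forall p, p < size lam -> nth 0 lam p < head 0 lam ->
        exists q, [/\ q < size lam, nth 0 lam p < nth 0 lam q,
          g p = nth 0 lam q - nth 0 lam p &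
          forall z, z \in lam -> nth 0 lam p < z -> nth 0 lam q <= z]
    & forall p, nth 0 lam p = head 0 lam ->
        exists q, [/\ q < size lam, nth 0 lam q < head 0 lam,
          g p = head 0 lam - nth 0 lam q &
          forall r, r < size lam -> nth 0 lam r < head 0 lam ->
            nth 0 lam r <= nth 0 lam q]].
Proof.
exists g; split.
- exact: bconst_sum_gaps.
- exact: gap_below_top.
- exact: gap_of_top.
Qed.

End Gaps.

(** * Feasibility *)

Lemma sum_Posz (I : Type) (r : seq I) (P : pred I) (F : I -> nat) :
  (\sum_(i <- r | P i) F i)%N%:Z = \sum_(i <- r | P i) (F i)%:Z.
Proof. exact: (big_morph Posz PoszD (erefl _)). Qed.

(** * From transports to partitions of the balls *)

Section Realization.

Variables (n d : nat) (x : 'I_n -> 'I_n -> int).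
Hypothesis tx : transport d x.

(** Entry [m] of [bins a] is the bin receiving the ball [(a, m)]. *)
Let bins a := flatten [seq nseq `|x i a|%N i | i <- index_enum 'I_n].

Lemma count_bins i a : count_mem i (bins a) = `|x i a|%N.
Proof.
rewrite /bins count_flatten sumnE 2!big_map.
under eq_bigr do rewrite count_nseq.
rewrite (bigD1 i) //= eqxx mul1n big1 ?addn0 // => j /negbTE ji.
by rewrite ji mul0n.
Qed.

Lemma size_bins a : size (bins a) = d.
Proof.
have [x0 _ xcol] := tx.
rewrite /bins size_flatten sumnE 2!big_map.
under eq_bigr do rewrite size_nseq.
apply/eqP; rewrite -eqz_nat sum_Posz -(xcol a); apply/eqP.
by apply: eq_bigr => i _; rewrite gez0_abs.
Qed.

Definition bin_of_transport i : {set ball n d} :=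
  [set b : ball n d | nth b.1 (bins b.1) b.2 == i].

Lemma sum_bin_of_transport i (F : 'I_n -> nat) :
  (\sum_(b in bin_of_transport i) F b.1 = \sum_a `|x i a| * F a)%N.
Proof.
transitivity (\sum_a \sum_(m < d | nth a (bins a) m == i) F a)%N.
  by rewrite pair_big_dep; apply: eq_bigl => b; rewrite inE.
apply: eq_bigr => a _; rewrite sum_nat_cond_const; congr muln.
rewrite -count_bins -sum1_count (big_nth a) size_bins big_mkord -sum1dep_card.
by apply: eq_bigl => m; rewrite !inE.
Qed.

Lemma feasible_of_transport (C : n.-tuple int) (w : n.-tuple nat) :
  (forall i, weight (fun a => (tnth w a)%:Z) x i <= tnth C i) ->
  feasible d C w.
Proof.
have [x0 xrow _] := tx => wC.
have absx i a : `|x i a|%N%:Z = x i a by rewrite gez0_abs.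
exists bin_of_transport; split.
- apply/setP => b; rewrite in_setT; apply/bigcupP.
  by exists (nth b.1 (bins b.1) b.2); rewrite // inE.
- move=> i j ij; rewrite -setI_eq0; apply/eqP/setP => b; rewrite !inE.
  by apply/andP => -[/eqP e /eqP e']; rewrite -e e' eqxx in ij.
- move=> i; rewrite -sum1_card (sum_bin_of_transport i (fun=> 1%N)).
  apply/eqP; rewrite -eqz_nat -(xrow i) sum_Posz; apply/eqP.
  by apply: eq_bigr => a _; rewrite muln1 absx.
- move=> i; apply: le_trans (wC i).
  rewrite /bin_weight sum_bin_of_transport sum_Posz.
  by apply: ler_sum => a _; rewrite PoszM absx.
Qed.

End Realization.

(** * Induction on the number of bins *)

Section CappedTransport.

Lemma head_tnth n (T : Type) (y : T) (t : n.+1.-tuple T) :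
  head y t = tnth t ord0.
Proof. by rewrite (tnth_nth y) nth0. Qed.

Lemma tnth_noninc n (w : n.-tuple nat) (a b : 'I_n) :
  sorted geq w -> (a <= b)%N -> (tnth w b <= tnth w a)%N.
Proof.
move=> ws ab; rewrite !(tnth_nth 0%N); apply: nth_noninc => //.
by rewrite size_tuple.
Qed.

Lemma tnth_noninc_int n (C : n.-tuple int) (p q : 'I_n) :
  sorted (fun y z : int => z <= y) C -> (p <= q)%N -> tnth C q <= tnth C p.
Proof.
move=> Cs pq; rewrite !(tnth_nth 0).
apply: (sorted_leq_nth _ _ 0 Cs); rewrite ?inE ?size_tuple //.
by move=> u v t vu ut; apply: le_trans ut vu.
Qed.

(** The new bin of index 0 receives exactly its own [d] balls. *)
Definition extend n (d : int) (x : 'I_n -> 'I_n -> int) (i a : 'I_n.+1) : int :=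
  match unlift ord0 i, unlift ord0 a with
  | Some i', Some a' => x i' a'
  | None, None => d
  | _, _ => 0
  end.

Lemma extend_transport n d (x : 'I_n -> 'I_n -> int) :
  0 <= d -> transport d x -> transport d (extend d x).
Proof.
move=> d0 [x0 xrow xcol]; split.
- by move=> i a; rewrite /extend; case: unlift => [i'|]; case: unlift.
- move=> i; rewrite big_ord_recl /extend unlift_none.
  under eq_bigr do rewrite liftK.
  by case: unlift => [i'|]; [rewrite add0r | rewrite big1 ?addr0].
- move=> a; rewrite big_ord_recl /extend unlift_none.
  under eq_bigr do rewrite liftK.
  by case: unlift => [a'|]; [rewrite add0r | rewrite big1 ?addr0].
Qed.

Lemma extend_weight_lift n d (x : 'I_n -> 'I_n -> int) w i :
  weight w (extend d x) (lift ord0 i) = weight (fun a => w (lift ord0 a)) x i.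
Proof.
rewrite /weight big_ord_recl /extend unlift_none liftK mul0r add0r.
by under eq_bigr do rewrite liftK.
Qed.

Lemma extend_weight0 n d (x : 'I_n -> 'I_n -> int) w :
  weight w (extend d x) ord0 = d * w ord0.
Proof.
rewrite /weight big_ord_recl /extend unlift_none.
under eq_bigr do rewrite liftK mul0r.
by rewrite big1 ?addr0.
Qed.

Lemma sum_tail_lift n (R : nmodType) (F : 'I_n.+1 -> R) (i : 'I_n) :
  \sum_(j < n.+1 | (lift ord0 i <= j)%N) F j
  = \sum_(j < n | (i <= j)%N) F (lift ord0 j).
Proof. by rewrite big_mkcond big_ord_recl /= add0r -big_mkcond. Qed.

(** The induction drops the first bin and its weight, so a fixed bound [D] on the weights replaces
    the largest weight in the threshold. *)
Lemma capped_transport n (w : n.-tuple nat) (C : n.-tuple int) (D d : nat) :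
  sorted geq w -> sorted (fun y z : int => z <= y) C -> (head 0%N w <= D)%N ->
  (n ^ 3 * D * (2 * n + D) <= d)%N ->
  (forall i, tail_bound d w i <= tail_capacity C i) ->
  exists2 x, transport d x
    & forall i, weight (fun a => (tnth w a)%:Z) x i <= tnth C i.
Proof.
elim: n w C => [|n IH] w C ws Cs wD dD wC.
  by exists (fun _ _ => 0); [split=> // -[]|case].
case/tupleP: w ws wD wC => w0 w; case/tupleP: C Cs => C0 C Cs ws wD wC.
have [x tx xC] : exists2 x, transport d x
    & forall i, weight (fun a => (tnth w a)%:Z) x i <= tnth C i.
  apply: IH.
  - exact: path_sorted ws.
  - exact: path_sorted Cs.
  - apply: leq_trans wD; have head_le s :
      sorted geq (w0 :: s) -> (head 0 s <= w0)%N by case: s => //= z s /andP [].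
    exact: head_le ws.
  - by apply: leq_trans dD; apply: leq_mul;
      rewrite ?leq_add2r ?leq_mul2r ?leq_mul2l ?leq_exp2r ?leqnSn ?orbT.
  - move=> i; have := wC (lift ord0 i).
    rewrite /tail_bound /tail_capacity !sum_tail_lift.
    under eq_bigr do rewrite tnthS.
    by under [X in _ <= X -> _]eq_bigr do rewrite tnthS.
set ws' := [tuple of w0 :: w] in ws wC *.
set Cs' := [tuple of C0 :: C] in Cs wC *.
have te := extend_transport (le0z_nat d) tx.
have ce i : i != ord0 -> weight (fun a => (tnth ws' a)%:Z) (extend d x) i
    <= tnth Cs' i.
  case: (unliftP ord0 i) => [j ->|-> //] _.
  rewrite extend_weight_lift tnthS /weight.
  by under eq_bigr do rewrite tnthS; apply: xC.
have [lt_last|ge_last] := ltnP (last 0%N ws') (head 0%N ws'); last first.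
  (* All weights are equal: the last capacity is at least [d] times this weight by its tail
     inequality, and the first capacity is no smaller. *)
  exists (extend d x) => // i; have [->|/ce //] := eqVneq i ord0.
  have last_only (R : nmodType) (F : 'I_n.+1 -> R) :
      \sum_(j < n.+1 | (@ord_max n <= j)%N) F j = F ord_max.
    apply: big_pred1 => j /=; apply/idP/eqP => [nj|-> //].
    by apply: val_inj => /=; have := ltn_ord j; lia.
  have := wC ord_max; rewrite /tail_bound /tail_capacity !last_only.
  have := tnth_noninc_int Cs (leq_ord (@ord0 n) : (ord0 <= @ord_max n)%N).
  have lastE : last 0%N ws' = tnth ws' ord_max.
    by rewrite (tnth_nth 0%N) -nth_last size_tuple.
  rewrite lastE head_tnth in ge_last.
  by rewrite extend_weight0; move: ge_last; clear; nia.
have [g [bg gb gt]] := bconst_gaps ws lt_last.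
have nthE (i : 'I_n.+1) : nth 0%N ws' i = tnth ws' i by rewrite (tnth_nth 0%N).
have szE : size ws' = n.+1 by rewrite size_tuple.
have headE : head 0%N ws' = tnth ws' ord0 by rewrite head_tnth.
have n1 : (0 < n)%N.
  rewrite lt0n; apply: contraTneq lt_last => n0.
  have e : (size ws').-1 = 0%N by rewrite szE n0.
  by rewrite -nth_last e nth0 ltnn.
have w0_max a : (tnth ws' a <= tnth ws' ord0)%N by apply: tnth_noninc.
have D1 : (0 < D)%N by move: wD lt_last; rewrite /=; lia.
apply: (@capped_transport_completes n d D _ (tnth Cs') (fun i => (g i)%:Z)
  _ _ _ _ _ _ _ _ _ (extend d x) te ce).
- by move=> a b ab; rewrite lez_nat; apply: tnth_noninc.
- by move=> p q; apply: tnth_noninc_int.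
- by [].
- by move=> a; rewrite lez_nat; apply: leq_trans wD; rewrite headE.
- move=> i _ [wi]; have [|q [qs qV gq qmax]] := gt i.
    by rewrite nthE headE.
  have qn : (q < n.+1)%N by rewrite -szE.
  have nq := nthE (Ordinal qn); rewrite /= in nq.
  exists (Ordinal qn); rewrite -nq -headE; split.
  + by rewrite ltz_nat.
  + move=> a; rewrite ltz_nat lez_nat -nthE; apply: qmax.
    by rewrite szE ltn_ord.
  + by rewrite gq -subzn // ltnW.
- move=> i; rewrite ltz_nat => wi; have [||q [qs qV gq qmin]] := gb i.
  + by rewrite szE.
  + by rewrite nthE headE.
  have qn : (q < n.+1)%N by rewrite -szE.
  have nq := nthE (Ordinal qn); rewrite /= in nq.
  by exists (Ordinal qn); rewrite -nq -nthE ?ltz_nat // gq -subzn // ltnW.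
- exists ord_max; rewrite ltz_nat -headE -nthE.
  by apply: leq_ltn_trans lt_last; rewrite -nth_last szE.
(* With [N = n.+1 >= 2], [N^3 D^2 >= 2 N^2 D^2] and [2 N^4 D > N^2 D + N D]. *)
- by move: dD n1 D1; clear; nia.
(* Positive gaps make the truncated [g p - 1] agree with the integer subtraction. *)
- have g_gt0 (i : 'I_n.+1) : (0 < g i)%N.
    have := w0_max i; rewrite leq_eqVlt => /orP [/eqP wi|wi].
      have [|q [_ qV -> _]] := gt i; first by rewrite nthE headE.
      by rewrite subn_gt0.
    have [||q [_ qV -> _]] := gb i; rewrite ?szE ?nthE ?headE ?subn_gt0 //.
    by rewrite -nthE.
  have := wC ord0; rewrite /tail_bound /tail_capacity drop0 bg.
  rewrite PoszD PoszM !sum_Posz => tot; apply: le_trans tot.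
  rewrite lerD2l szE big_add1 big_mkord big_mkcond big_ord_recl /= add0r.
  by apply: ler_sum => i _; rewrite -subzn //; apply: (g_gt0 (lift ord0 i)).
Qed.

End CappedTransport.

(** * Sharpness *)

Section Sharpness.

(** Every column has the full height 1, so there are no heights and the case [k = 0] applies. *)
Lemma bconst_singleton v : bconst [:: v] = 0%N.
Proof.
suff -> : bconst [:: v] =
    (if size (conj_heights [:: v]) == 0%N then 0%N else bconst [:: v]).
  case hs: (conj_heights [:: v]) => [//|c s].
  have : c \in conj_heights [:: v] by rewrite hs mem_head.
  case/conj_heightsP => j /= jv [_]; rewrite /count_ge /=; lia.
by rewrite /bconst; case: (size _).
Qed.

(** The gap at [p] reaches the next larger part, which is at most the part at [p.-1]. *)
Lemma bconst_le_gaps lam : sorted gtn lam ->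
  (bconst lam <= \sum_(1 <= p < size lam) (nth 0 lam p.-1 - nth 0 lam p - 1))%N.
Proof.
move=> ls; have ls' : sorted geq lam.
  by move: ls; rewrite gtn_sorted_uniq_geq => /andP [].
have gtn_nth p q : (p < q < size lam)%N -> (nth 0 lam q < nth 0 lam p)%N.
  move=> pq; apply: (sorted_ltn_nth gtn_trans 0%N ls); rewrite ?inE; lia.
case e: lam => [|v [|v' s]].
- by [].
- by rewrite bconst_singleton.
rewrite -e; have lt_last : (last 0%N lam < head 0%N lam)%N.
  by rewrite -nth_last -nth0; apply: gtn_nth; rewrite e /=; lia.
have [g [-> gb _]] := bconst_gaps ls' lt_last.
rewrite big_nat_cond [leqRHS]big_nat_cond; apply: leq_sum => p.
rewrite andbT => pl; apply: leq_sub2r.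
have [||q [ql qp -> qmin]] := gb p; first by lia.
  by rewrite -nth0; apply: gtn_nth; lia.
apply: leq_sub2r; apply: qmin; last by apply: gtn_nth; lia.
by apply: mem_nth; case/andP: pl => _; apply: leq_ltn_trans (leq_pred p).
Qed.

(** * The tight capacities *)

Variables (n d : nat) (w : n.-tuple nat) (i0 : 'I_n).
Hypotheses (w_decr : sorted gtn w) (d_gt0 : (0 < d)%N).

Let u p := nth 0%N w p.

Lemma weight_decr p q : (p < q < n)%N -> (u q < u p)%N.
Proof.
move=> pq; apply: (sorted_ltn_nth gtn_trans 0%N w_decr);
  rewrite ?inE ?size_tuple; lia.
Qed.

(** The extra 1 makes up for the unit missing in the inequality at [i0]. *)
Let large := 1 + \sum_i tail_bound d w i.

(* Bins after [i0] are filled by balls of their own type only: a single heavier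
   ball would exceed the capacity by one. *)
Let cap (p : nat) : int :=
  if (p < i0)%N then large else
  if p == i0 then d%:Z * (u p)%:Z - 1
  else d%:Z * (u p)%:Z + ((u p.-1)%:Z - (u p)%:Z - 1).

Definition tight_capacities : n.-tuple int := [tuple cap i | i < n].

Lemma tail_bound_nat (i : 'I_n) : tail_bound d w i =
  d%:Z * (\sum_(i <= p < n) (u p)%:Z) + (bconst (drop i w))%:Z.
Proof.
rewrite /tail_bound PoszD PoszM sum_Posz big_geq_mkord.
by congr (_ * _ + _); apply: eq_bigr => p _; rewrite (tnth_nth 0%N).
Qed.

Lemma tail_capacity_nat (i : 'I_n) :
  tail_capacity tight_capacities i = \sum_(i <= p < n) cap p.
Proof.
rewrite /tail_capacity big_geq_mkord.
by apply: eq_bigr => p _; rewrite tnth_mktuple.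
Qed.

Lemma bconst_drop_le (i : 'I_n) : (bconst (drop i w))%:Z
  <= \sum_(i.+1 <= p < n) ((u p.-1)%:Z - (u p)%:Z - 1).
Proof.
have : (bconst (drop i w) <=
    \sum_(i.+1 <= p < n) (u p.-1 - u p - 1))%N.
  apply: leq_trans (bconst_le_gaps _) _; first exact: drop_sorted.
  rewrite size_drop size_tuple -[i.+1]add1n big_addn.
  rewrite big_nat_cond [leqRHS]big_nat_cond; apply: leq_sum => p.
  rewrite andbT => pl; rewrite !nth_drop -/(u _) -/(u _).
  by rewrite (_ : i + p = p + i)%N 1?(_ : i + p.-1 = (p + i).-1)%N //; lia.
rewrite -lez_nat sum_Posz => /le_trans; apply.
rewrite big_nat_cond [leRHS]big_nat_cond; apply: ler_sum => p.
rewrite andbT => pl; have := @weight_decr p.-1 p ltac:(lia); lia.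
Qed.

Lemma tail_bound_ge0 i : 0 <= tail_bound d w i.
Proof. by []. Qed.

Lemma tail_bound_le_large i : tail_bound d w i + 1 <= large.
Proof.
rewrite /large addrC lerD2l (bigD1 i) //= lerDl.
by apply: sumr_ge0 => j _; apply: tail_bound_ge0.
Qed.

Lemma sum_cap_after (i : nat) : (i0 < i)%N -> \sum_(i <= p < n) cap p =
  d%:Z * (\sum_(i <= p < n) (u p)%:Z)
  + \sum_(i <= p < n) ((u p.-1)%:Z - (u p)%:Z - 1).
Proof.
move=> ii; rewrite mulr_sumr -big_split; apply: eq_big_nat => p.
case/andP => ip _; have ltp := leq_trans ii ip.
by rewrite /cap ltnNge (ltnW ltp) /= gtn_eqF.
Qed.

Lemma tight_tail_after (i : 'I_n) : (i0 < i)%N ->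
  tail_bound d w i <= tail_capacity tight_capacities i.
Proof.
move=> ii; rewrite tail_bound_nat tail_capacity_nat sum_cap_after //.
rewrite lerD2l; apply: le_trans (bconst_drop_le i) _.
(* The capacities also contain the term of [p = i], nonnegative as the weights strictly decrease. *)
rewrite [leRHS]big_ltn // lerDr.
by have := @weight_decr i.-1 i ltac:(have := ltn_ord i; lia); lia.
Qed.

Lemma tight_tail_at :
  tail_bound d w i0 - 1 <= tail_capacity tight_capacities i0.
Proof.
rewrite tail_bound_nat tail_capacity_nat !(@big_ltn _ _ _ i0) //.
rewrite sum_cap_after // mulrDr /cap ltnn eqxx.
have regroup (a s b : int) : a + s + b - 1 = a - 1 + (s + b) by lia.
by rewrite regroup !lerD2l; apply: bconst_drop_le.
Qed.

Lemma tight_tail_before (i : 'I_n) : (i < i0)%N ->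
  tail_bound d w i <= tail_capacity tight_capacities i.
Proof.
move=> ii; rewrite tail_capacity_nat.
rewrite (big_cat_nat (ltnW ii) (ltnW (ltn_ord i0))) /=.
have rest : -1 <= \sum_(i0 <= p < n) cap p.
  rewrite -tail_capacity_nat; apply: le_trans tight_tail_at.
  by have := tail_bound_ge0 i0; lia.
rewrite big_ltn // {1}/cap ii.
suff ge0 : 0 <= \sum_(i.+1 <= p < i0) cap p.
  rewrite -addrA.
  apply: le_trans (lerD (tail_bound_le_large i) (lerD ge0 rest)).
  by rewrite add0r addrK.
rewrite big_nat_cond; apply: sumr_ge0 => p; rewrite andbT => pi.
rewrite /cap (_ : (p < i0)%N = true); last by lia.
by have := tail_bound_le_large i; have := tail_bound_ge0 i; lia.
Qed.

(** From [i0] on, consecutive capacities drop by [(d - 1) * (u p - u p.+1)], increased by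
    [u p.-1 - u p] when [p > i0]; [large] dominates the capacity at [i0]. *)
Lemma tight_capacities_noninc :
  sorted (fun y z : int => z <= y) tight_capacities.
Proof.
apply/(sortedP 0) => p; rewrite size_tuple => pn.
have pn' : (p < n)%N by lia.
have capE q (qn : (q < n)%N) : nth 0 tight_capacities q = cap q.
  by rewrite -(tnth_nth 0 _ (Ordinal qn)) tnth_mktuple.
rewrite !capE //.
have [pi|ip] := ltnP p i0.
  rewrite {2}/cap pi.
  have [pi'|ip'] := ltnP p.+1 i0; first by rewrite /cap pi'.
  have e : p.+1 = i0 by lia.
  rewrite /cap e ltnn eqxx.
  apply: le_trans (tail_bound_le_large i0).
  rewrite tail_bound_nat big_ltn // mulrDr.
  rewrite -!addrA lerD2l; apply: (@le_trans _ _ 0) => //.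
  by rewrite !addr_ge0 // mulr_ge0 // sumr_ge0.
have dec := @weight_decr p p.+1 ltac:(lia).
have [e|pi] := eqVneq p i0.
  rewrite /cap e ltnn eqxx (_ : (i0.+1 < i0)%N = false); last by lia.
  rewrite (_ : (i0.+1 == i0 :> nat) = false); last by lia.
  by rewrite -e /=; nia.
have dec' := @weight_decr p.-1 p ltac:(lia).
have ltp : (i0 < p)%N by rewrite ltn_neqAle eq_sym pi.
rewrite /cap ltnNge (leqW ip) ltnNge ip gtn_eqF ?leqW //= gtn_eqF //.
by move: dec dec' d_gt0; move: (u p.-1) (u p) (u p.+1); clear; nia.
Qed.

Lemma tight_infeasible : ~ feasible d tight_capacities w.
Proof.
move=> [B [_ dis cardB wB]].
have type_le (i : 'I_n) :
    (forall j : 'I_n, (i < j)%N -> B j = [set b | b.1 == j]) ->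
    forall b, b \in B i -> (b.1 <= i)%N.
  move=> Bj b bi; rewrite leqNgt; apply/negP => lt.
  have /pred0P/(_ b) := dis i b.1 (negbT (ltn_eqF lt : (i == b.1) = false)).
  by rewrite /= bi Bj // inE eqxx.
have weight_ge (i : 'I_n) (b : ball n d) :
    (b.1 <= i)%N -> (u i <= tnth w b.1)%N.
  rewrite (tnth_nth 0%N) leq_eqVlt => /orP [/eqP -> //|lt].
  by apply/ltnW/weight_decr; rewrite lt ltn_ord.
(* Downward induction from the last bin; [m] bounds the number of bins from [i] on. *)
have own_type m (i : 'I_n) : (n - i <= m)%N -> (i0 < i)%N ->
    B i = [set b | b.1 == i].
  elim: m i => [|m IH] i im ii; first by have := ltn_ord i; lia.
  have {}type_le b : b \in B i -> (b.1 <= i)%N.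
    by apply: type_le => j ij; apply: IH; lia.
  apply/eqP; rewrite eqEcard; apply/andP; split; last first.
    rewrite cardB (_ : [set b | b.1 == i] = setX [set i] [set: 'I_d]).
      by rewrite cardsX cards1 cardsT card_ord mul1n.
    by apply/setP => b; rewrite !inE andbT.
  apply/subsetP => b bi; rewrite inE -val_eqE /= eqn_leq type_le //=.
  rewrite leqNgt; apply/negP => lt.
  have := wB i; rewrite tnth_mktuple /cap (_ : (i < i0)%N = false); last by lia.
  rewrite (_ : (i == i0 :> nat) = false); last by lia.
  rewrite /bin_weight (big_setD1 b bi) /=.
  have := cardsD1 b (B i); rewrite cardB bi => card_rest.
  have : (#|B i :\ b| * u i <= \sum_(c in B i :\ b) tnth w c.1)%N.
    rewrite -sum_nat_const.
    by apply: leq_sum => c; rewrite inE => /andP [_ /type_le/weight_ge].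
  have : (u i.-1 <= tnth w b.1)%N.
    rewrite (tnth_nth 0%N) -/(u _).
    have : (b.1 <= i.-1)%N by rewrite -ltnS (ltn_predK lt).
    rewrite leq_eqVlt => /orP [/eqP -> //|lt'].
    by apply/ltnW/weight_decr; rewrite lt' (leq_ltn_trans (leq_pred i)).
  move: card_rest; move: (\sum_(_ in _) _)%N (tnth w b.1) (u i) (u i.-1).
  by move: #|_| => r s t v v' -> /=; clear; nia.
(* By [own_type], bin [i0] has no ball lighter than [u i0], so it weighs at least [d * u i0], above
   its capacity. *)
have := wB i0; rewrite tnth_mktuple /cap ltnn eqxx.
have : (d * u i0 <= bin_weight w (B i0))%N.
  rewrite -[X in (X * _ <= _)%N](cardB i0) -sum_nat_const.
  apply: leq_sum => b bi.
  apply: weight_ge; apply: type_le bi => j ij.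
  exact: (own_type n j (leq_subr _ _)).
by clear; nia.
Qed.

End Sharpness.

Local Close Scope ring_scope.

Theorem theorem1p7 (n : nat) (n_gt0 : 0 < n) (w : n.-tuple nat)
    (w_noninc : sorted geq w) :
  (forall d : nat, 0 < d -> d_threshold w <= d ->
     forall C : n.-tuple int, sorted (fun x y : int => (y <= x)%R) C ->
       (forall i : 'I_n, (tail_bound d w i <= tail_capacity C i)%R) ->
       feasible d C w)
  /\
  (sorted gtn w ->
   forall d : nat, 0 < d -> d_threshold w <= d ->
   forall i0 : 'I_n,
     exists C : n.-tuple int,
       [/\ sorted (fun x y : int => (y <= x)%R) C,
           forall i : 'I_n, i != i0 ->
             (tail_bound d w i <= tail_capacity C i)%R,
           (tail_bound d w i0 - 1 <= tail_capacity C i0)%R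
         & ~ feasible d C w]).
Proof.
split=> [d _ dw C Cs wC|w_decr d d_gt0 _ i0].
  have [x tx xC] := capped_transport w_noninc Cs (leqnn _) dw wC.
  exact: (feasible_of_transport tx).
exists (tight_capacities d w i0); split.
- exact: tight_capacities_noninc.
- move=> i; rewrite -val_eqE /= neq_ltn => /orP [ii|ii].
    exact: tight_tail_before.
  exact: tight_tail_after.
- exact: tight_tail_at.
- exact: tight_infeasible.
Qed.
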